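(* For every 2-connected partial $k$-tree $G$, $\mathrm{lct}(G)\leq k-1$.
   Context: All graphs are finite and simple. A $k$-tree is defined recursively: the complete graph on $k$ vertices is a $k$-tree, and any graph obtained from a $k$-tree by adding a new vertex adjacent to exactly the vertices of an existing $k$-clique is a $k$-tree. A partial $k$-tree is a subgraph of a $k$-tree (equivalently, a graph of treewidth at most $k$). $\mathrm{lct}(G)$ is the minimum cardinality of a set of vertices that intersects every longest cycle (cycle of maximum length) of $G$. *)

(* Defs.v *)
From mathcomp Require Import all_boot.
Set Implicit Arguments. Unset Strict Implicit. Unset Printing Implicit Defensive.

Definition simple_graph (T : finType) (e : rel T) : Prop :=
  symmetric e /\ irreflexive e.

Definition clique (T : finType) (e : rel T) (C : {set T}) : Prop :=
  {in C &, forall x y, x != y -> e x y}.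

(* ktree_on e k S : the subgraph of (T,e) induced on S is a k-tree, following the
   recursive definition: K_k is a k-tree; adding a new vertex v whose neighbourhood
   (inside the current vertex set) is exactly a k-clique C gives a k-tree. *)
Inductive ktree_on (T : finType) (e : rel T) (k : nat) : {set T} -> Prop :=
| kt_base (S : {set T}) : #|S| = k -> clique e S -> ktree_on e k S
| kt_add (S : {set T}) (v : T) (C : {set T}) :
    ktree_on e k S -> v \notin S -> C \subset S -> #|C| = k -> clique e C ->
    [set u in S | e v u] = C -> ktree_on e k (v |: S).

Definition is_ktree (T : finType) (e : rel T) (k : nat) : Prop :=
  simple_graph e /\ ktree_on e k [set: T].

Definition partial_ktree (T : finType) (e : rel T) (k : nat) : Prop :=
  exists (U : finType) (f : T -> U) (eU : rel U),
    [/\ injective f, is_ktree eU k & forall x y, e x y -> eU (f x) (f y)].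

Definition connected_in (T : finType) (e : rel T) (S : {set T}) : Prop :=
  forall x y, x \in S -> y \in S ->
    connect [rel a b | [&& e a b, a \in S & b \in S]] x y.

Definition two_connected (T : finType) (e : rel T) : Prop :=
  [/\ 3 <= #|T|, connected_in e [set: T] & forall v : T, connected_in e [set~ v]].

Definition is_cycle (T : finType) (e : rel T) (c : seq T) : Prop :=
  [/\ uniq c, 3 <= size c & cycle e c].

Definition longest_cycle (T : finType) (e : rel T) (c : seq T) : Prop :=
  is_cycle e c /\ forall c' : seq T, is_cycle e c' -> size c' <= size c.

Definition hits_longest_cycles (T : finType) (e : rel T) (S : {set T}) : Prop :=
  forall c : seq T, longest_cycle e c -> has (fun x => x \in S) c.

Definition is_lct (T : finType) (e : rel T) (n : nat) : Prop :=
  (exists S : {set T}, #|S| = n /\ hits_longest_cycles e S) /\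
  (forall S : {set T}, hits_longest_cycles e S -> n <= #|S|).

(* Main.v *)
Require Import Defs.
From mathcomp Require Import all_boot.

(* Two longest cycles of a 2-connected graph share two vertices: otherwise two
   disjoint paths between them (one possibly reduced to a common vertex), together
   with a longer arc of each, form a longer cycle.

   Suppose no set of k - 1 vertices meets all longest cycles of G, a subgraph of the
   k-tree K. For each k-clique Q of K some longest cycle meets Q at most once, and by
   the first fact all such cycles live in the same component of K - Q. Choosing Q
   with this component minimal and b in it adjacent to all of Q, the clique
   B = Q + b has the property that for each b' in B the clique B - b' selects the
   component of b'. Every component of K - B misses some m in B (K has no clique on
   k + 2 vertices), so no longest cycle meets B at most once, and hence for all
   distinct a, b in B there is a longest cycle C_ab meeting B exactly in a and b.
   Its two arcs lie in components of K - B missing m1, m2 in B \ {a, b}. A longest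
   cycle C_cd with m1, m2 in {c, d} cannot enter these components, so it shares at
   most one vertex with C_ab, a contradiction. *)

Set Implicit Arguments.
Unset Strict Implicit.
Unset Printing Implicit Defensive.

Lemma cat_uniqP (T : eqType) (s1 s2 : seq T) :
  reflect [/\ uniq s1, uniq s2 & {in s1, forall x, x \notin s2}] (uniq (s1 ++ s2)).
Proof.
rewrite cat_uniq; apply: (iffP and3P) => [[u1 /hasPn d u2]|[u1 u2 d]]; split=> //.
  by move=> x x1; apply/negP=> /d; rewrite /= x1.
by apply/hasPn=> x x2; apply/negP=> /d; rewrite x2.
Qed.

(** * Disjoint paths in 2-connected graphs *)

Section TwoConnected.
Variables (T : finType) (e : rel T).
Hypotheses (e_sym : symmetric e) (e_irr : irreflexive e).

Lemma connected_in_path (S : {set T}) x y :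
    connected_in e S -> x \in S -> y \in S ->
  exists p, [/\ path e x p, last x p = y, uniq (x :: p)
              & {subset x :: p <= S}].
Proof.
move=> conS xS yS; case/connectP: (conS x y xS yS) => p0 p0P ->.
case/shortenP: p0P => p pP uP _; exists p; split=> //.
  by apply: sub_path pP => a b /and3P[].
move=> z; rewrite inE => /predU1P[-> //|].
elim: p x xS pP uP => //= a p IH x xS /andP[/and3P[_ _ aS] pP] /andP[_ uP].
rewrite inE => /predU1P[-> //|]; exact: (IH a).
Qed.

Lemma rev_upath x p : path e x p -> uniq (x :: p) ->
  exists q, [/\ path e (last x p) q, last (last x p) q = x,
    uniq (last x p :: q), size q = size p & last x p :: q =i x :: p].
Proof.
move=> pP uP; exists (rev (belast x p)).
have E : last x p :: rev (belast x p) = rev (x :: p).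
  by rewrite [in RHS]lastI rev_rcons.
split.
- by rewrite rev_path; under eq_path do rewrite e_sym.
- by case: p {pP uP E} => //= a p; rewrite rev_cons last_rcons.
- by rewrite E rev_uniq.
- by rewrite size_rev size_belast.
- by move=> z; rewrite E mem_rev.
Qed.

(** Strong induction on the length: restart at a later vertex of [X], or stop at an earlier vertex
    of [Y], until neither exists. *)
Lemma trim_path (X Y : {pred T}) x p :
    path e x p -> uniq (x :: p) -> x \in X -> last x p \in Y ->
  exists x' p', [/\ path e x' p', uniq (x' :: p'), {subset x' :: p' <= x :: p},
      x' \in X /\ last x' p' \in Y
    & {in x' :: p', forall z, (z \in X -> z = x') /\ (z \in Y -> z = last x' p')}].
Proof.
elim: (size p).+1 {-2}p x (ltnSn (size p)) => // n IH {}p x szp pP uP xX lY.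
have [/hasP[z zp zX]|/hasPn nX] := boolP (has (mem X) p).
  case/splitPr: zp pP uP lY szp => p1 p2.
  rewrite cat_path last_cat -cat_cons size_cat addnS ltnS => /andP[_ /andP[_ p2P]].
  move=> /cat_uniqP[_ up2 _] lY szp.
  have [||x' [p' [? ? sub ? ?]]] := IH p2 z _ p2P _ zX lY.
  - by apply: leq_trans szp; rewrite ltnS leq_addl.
  - exact: up2.
  exists x', p'; split=> // w /sub wz.
  by rewrite mem_cat wz orbT.
have [/hasP[z zp zY]|/hasPn nY] := boolP (has (mem Y) (belast x p)); last first.
  exists x, p; split=> // z zp; split=> [zX|zY].
    by move: zp; rewrite inE => /predU1P[//|/nX]; rewrite /= zX.
  move: zp; rewrite lastI mem_rcons inE => /predU1P[//|/nY].
  by rewrite /= zY.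
have z_last : z != last x p.
  by apply: contraTneq zp => ->; move: uP; rewrite lastI rcons_uniq => /andP[].
case/splitPl: (mem_belast zp) z_last pP uP szp => p1 p2 z_last zp2.
rewrite cat_path -cat_cons size_cat => /andP[p1P _] /cat_uniqP[u1 _ _] szp.
have p2_gt0 : 0 < size p2 by case: p2 zp2 {szp} => //; rewrite cats0 z_last eqxx.
have [||x' [p' [? ? sub ? ?]]] := IH p1 x _ p1P u1 xX.
- by rewrite -ltnS (leq_trans _ szp) // ltnS -addn1 leq_add2l.
- by rewrite z_last.
exists x', p'; by split=> // w /sub wx; rewrite mem_cat wx.
Qed.

Hypothesis conD1 : forall v, connected_in e [set~ v].

Definition disjoint_paths_to (A : {pred T}) u v :=
  exists p q, [/\ path e u p, path e v q, last u p \in A, last v q \in A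
                & uniq ((u :: p) ++ v :: q)].

Lemma path_avoiding (A : {pred T}) a1 a2 u v :
    a1 \in A -> a2 \in A -> a1 != a2 -> u != v ->
  exists p, [/\ path e u p, last u p \in A, uniq (u :: p) & v \notin u :: p].
Proof.
move=> a1A a2A a12 uv; have [a aA av] : exists2 a, a \in A & a != v.
  by case: (eqVneq a1 v) => [E|]; [exists a2; rewrite // -E eq_sym|exists a1].
have [||p [? lp ? sub]] := @connected_in_path [set~ v] u a (@conD1 v).
- by rewrite !inE.
- by rewrite !inE.
exists p; split=> //; first by rewrite lp.
by apply/negP=> /sub; rewrite !inE eqxx.
Qed.

(** Here [q1] and [q2] form a fan from [v] to [A], and [r] leads from [u] to its first contact [w]
    with the fan. From [w] on, [u] takes over the rest of [q1], while [v] keeps [q2]. *)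
Lemma disjoint_paths_reroute (A : {pred T}) u v r w q1 q2 :
    path e u (rcons r w) -> uniq (u :: rcons r w) -> v \notin u :: r ->
    {in u :: r, forall x, x \notin q1 ++ q2} -> w \in q1 ->
    path e v q1 -> path e v q2 -> last v q1 \in A -> last v q2 \in A ->
    uniq (v :: q1 ++ q2) ->
  disjoint_paths_to A u v.
Proof.
move=> rP ur nv dis wq q1P q2P l1 l2 uq.
case/splitPr: wq q1P uq l1 dis => t1 t2.
rewrite cat_path last_cat => /andP[_ /andP[_ tP]] + l1 dis.
rewrite cons_uniq => /andP[nvq /cat_uniqP[/cat_uniqP[_ /andP[wt ut] _] u2 d12]].
exists (rcons r w ++ t2), q2; split=> //.
- by rewrite cat_path rP last_rcons.
- by rewrite last_cat last_rcons.
move: nvq; rewrite !mem_cat !inE !negb_or => /andP[/and3P[_ vw vt] vq2].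
have in_r x : x \in u :: rcons r w -> (x \in u :: r) || (x == w).
  by rewrite !inE mem_rcons inE => /or3P[->|->|->]; rewrite ?orbT.
rewrite -cat_cons; apply/cat_uniqP; split.
- apply/cat_uniqP; split=> // x /in_r/orP[/dis|/eqP->//].
  by rewrite !mem_cat !inE !negb_or => /andP[/and3P[]].
- by rewrite /= vq2.
- move=> x; rewrite mem_cat inE negb_or => /orP[/in_r/orP[xr|/eqP->]|xt].
  + apply/andP; split; first by apply: contraNneq nv => <-.
    by move/dis: xr; rewrite !mem_cat !negb_or => /andP[].
  + by rewrite eq_sym vw d12 // mem_cat inE eqxx orbT.
  + apply/andP; split; first by apply: contraNneq vt => <-.
    by apply: d12; rewrite mem_cat inE xt !orbT.
Qed.

Lemma disjoint_paths_on_fan (A : {pred T}) u v q1 q2 : u \in q1 ->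
    path e v q1 -> path e v q2 -> last v q1 \in A -> last v q2 \in A ->
    uniq (v :: q1 ++ q2) ->
  disjoint_paths_to A u v.
Proof.
move=> uq1 q1P q2P l1 l2; case/splitPr: uq1 q1P l1 => t1 t2.
rewrite cat_path last_cat => /andP[_ /andP[_ tP]] l1.
rewrite cons_uniq -catA => /andP[nvq /cat_uniqP[_ ut _]].
exists t2, q2; split=> //.
move: nvq ut; rewrite mem_cat negb_or => /andP[_ nvq] ut.
by rewrite (perm_uniq (permEl (perm_catCA (u :: t2) [:: v] q2))) /= nvq.
Qed.

(** Either [u] lies on the fan at [v] and cuts one of its branches, or a path from [u] to [A] that
    avoids [v] is followed up to its first contact with the fan, if there is one. *)
Lemma disjoint_paths_fan (A : {pred T}) a1 a2 u v q1 q2 :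
    a1 \in A -> a2 \in A -> a1 != a2 -> u != v ->
    path e v q1 -> path e v q2 -> last v q1 \in A -> last v q2 \in A ->
    uniq (v :: q1 ++ q2) ->
  disjoint_paths_to A u v.
Proof.
move=> a1A a2A a12 uv q1P q2P l1 l2 uq.
have uqC : uniq (v :: q2 ++ q1).
  by rewrite (perm_uniq (_ : perm_eq _ (v :: q1 ++ q2))) // perm_cons perm_catC.
have [uq1|nuq1] := boolP (u \in q1); first exact: (disjoint_paths_on_fan uq1 q1P q2P).
have [uq2|nuq2] := boolP (u \in q2); first exact: (disjoint_paths_on_fan uq2 q2P q1P).
have [r [rP lr ur nv]] := path_avoiding a1A a2A a12 uv.
have [hr|/hasPn nr] := boolP (has (mem (q1 ++ q2)) r); last first.
  exists r, q1; split=> //; apply/cat_uniqP; split=> //.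
    by move: uq; rewrite -cat_cons => /cat_uniqP[].
  move=> x xr; rewrite inE negb_or; apply/andP; split.
    by apply: contraNneq nv => <-.
  move: xr; rewrite inE => /predU1P[-> //|/nr].
  by rewrite /= mem_cat negb_or => /andP[].
case: (split_find hr) rP ur nv => w r1 r2 wq nr1.
rewrite cat_path -cat_cons mem_cat => /andP[r1P _] /cat_uniqP[ur1 _ _].
rewrite negb_or -rcons_cons mem_rcons inE negb_or => /andP[/andP[_ nv] _].
have dis : {in u :: r1, forall x, x \notin q1 ++ q2}.
  move=> x; rewrite inE => /predU1P[->|xr1]; first by rewrite mem_cat negb_or nuq1.
  by move/hasPn: nr1; apply.
move: wq; rewrite /= mem_cat => /orP[wq1|wq2].
  exact: (disjoint_paths_reroute r1P ur1 nv dis wq1 q1P q2P).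
apply: (disjoint_paths_reroute r1P ur1 nv _ wq2 q2P q1P) => // x /dis.
by rewrite !mem_cat orbC.
Qed.

(** A case of Menger's theorem, by induction along a path from [v] to [A]. For the next vertex [w],
    the induction hypothesis gives disjoint paths from [v] and from [w]; prefixing the second with
    the edge [v w] yields a fan at [v]. *)
Lemma disjoint_paths_exist (A : {pred T}) a1 a2 :
    a1 \in A -> a2 \in A -> a1 != a2 ->
  forall r v, path e v r -> last v r \in A ->
  forall u, u != v -> disjoint_paths_to A u v.
Proof.
move=> a1A a2A a12; elim=> [|w r IH] v /=.
  move=> _ vA u uv; have [p [pP lp up nv]] := path_avoiding a1A a2A a12 uv.
  by exists p, [::]; split; rewrite // cats1 rcons_uniq nv.
move=> /andP[evw rP] lr u uv.
have vw : v != w by apply: contraTneq evw => ->; rewrite e_irr.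
have [q1 [q2 [q1P q2P l1 l2 uq]]] := IH w rP lr v vw.
by apply: (disjoint_paths_fan a1A a2A a12 uv q1P _ l1 _ uq); rewrite //= evw.
Qed.

(** * Arcs of cycles, and the intersection of two longest cycles *)

Lemma cycle_split c x y : is_cycle e c -> x \in c -> y \in c -> x != y ->
  exists s t, [/\ path e x (rcons s y), path e y (rcons t x),
    uniq (x :: s ++ y :: t), c =i x :: s ++ y :: t
    & size c = (size s + size t).+2].
Proof.
case=> uc _ cc xc yc xy; case: (rot_to xc) => i c' Ec.
have sub : c =i x :: c' by move=> z; rewrite -Ec mem_rot.
have szc : size c = (size c').+1 by rewrite -(size_rot i) Ec.
have uc' : uniq (x :: c') by rewrite -Ec rot_uniq.
have cc' : cycle e (x :: c') by rewrite -Ec rot_cycle.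
have yc' : y \in c' by move: yc; rewrite sub inE eq_sym (negbTE xy).
case/splitPr: yc' szc sub uc' cc' => s t; rewrite size_cat addnS => szc sub uc'.
rewrite /= rcons_cat -cat_rcons cat_path last_rcons => /andP[sP tP].
by exists s, t.
Qed.

(** The longer of the two arcs; [size p] counts its edges, hence at least half of those of [c]. *)
Lemma cycle_arc c x y : is_cycle e c -> x \in c -> y \in c -> x != y ->
  exists p, [/\ path e x p, last x p = y, uniq (x :: p), {subset x :: p <= c}
              & size c <= (size p).*2].
Proof.
move=> cC xc yc xy; have [s [t [sP tP uc Ec szc]]] := cycle_split cC xc yc xy.
have [ts|/ltnW st] := leqP (size t) (size s).
  exists (rcons s y); split=> //; rewrite ?last_rcons //.
  - by move: uc; rewrite -cat_rcons -cat_cons => /cat_uniqP[].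
  - by move=> z zs; rewrite Ec -cat_rcons -cat_cons mem_cat zs.
  - by rewrite szc size_rcons doubleS !ltnS -addnn leq_add2l.
have uc' : uniq ((y :: rcons t x) ++ s).
  by rewrite (perm_uniq (_ : perm_eq _ (x :: s ++ y :: t))) //
    cat_cons cat_rcons -cat_cons perm_catC.
have [ut _ _] := cat_uniqP _ _ uc'.
have [] := rev_upath tP ut; rewrite last_rcons => q [qP lq uq szq qt].
exists q; split=> //.
  by move=> z; rewrite qt Ec !inE mem_cat mem_rcons !inE => /or3P[]->; rewrite ?orbT.
by rewrite szq szc size_rcons doubleS !ltnS -addnn leq_add2r.
Qed.

(** The longer cycle runs along an arc of [c] from [x1] to [x2], then [p], an arc of [d] from [y2]
    to [y1], and [q]. The arcs alone have at least [size c] edges, and [p] adds one. An empty [q] is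
    allowed: then [x1 = y1] is a vertex common to both cycles. *)
Lemma join_cycles c d x1 x2 y1 y2 p q :
    is_cycle e c -> is_cycle e d -> size c = size d ->
    x1 \in c -> x2 \in c -> x1 != x2 -> y1 \in d -> y2 \in d -> y1 != y2 ->
    path e x2 p -> last x2 p = y2 -> uniq (x2 :: p) ->
    path e y1 q -> last y1 q = x1 -> uniq (y1 :: q) ->
    {in p, forall z, z \notin c /\ (z \in d -> z = y2)} ->
    {in q, forall z, z \notin d /\ (z \in c -> z = x1)} ->
    {in p, forall z, z \notin q} -> {in c, forall z, z \in d -> z = x1} -> 0 < size p ->
  exists2 c', is_cycle e c' & size c < size c'.
Proof.
move=> cC dC scd x1c x2c x12 y1d y2d y12 pP lp up qP lq uq pout qout dpq dcd p_gt0.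
have [s [sP ls us sub_s szs]] := cycle_arc cC x1c x2c x12.
have [|t [tP lt ut sub_t szt]] := cycle_arc dC y2d y1d; first by rewrite eq_sym.
have P : path e x1 (s ++ p ++ t ++ q).
  by rewrite !cat_path sP ls pP lp tP lt qP.
have L : last x1 (s ++ p ++ t ++ q) = x1 by rewrite !last_cat ls lp lt.
have sz : size c < size (s ++ p ++ t ++ q).
  have : size c <= size s + size t.
    by rewrite -leq_double doubleD -addnn {2}scd leq_add.
  rewrite !size_cat addnCA => le_c; apply: leq_trans (leq_add p_gt0 (leqnn _)).
  by rewrite add1n ltnS addnA (leq_trans le_c) // leq_addr.
have s_c z : z \in s -> z \in c by move=> zs; rewrite sub_s // inE zs orbT.
have t_d z : z \in t -> z \in d by move=> zt; rewrite sub_t // inE zt orbT.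
exists (s ++ p ++ t ++ q) => //; split.
- move: us up ut uq => /andP[x1s us] /andP[_ up] /andP[y2t ut] /andP[_ uq].
  apply/cat_uniqP; split=> //; first (apply/cat_uniqP; split=> //; first apply/cat_uniqP).
  + split=> // z zt; apply/negP=> /qout[/negP[]]; exact: t_d.
  + move=> z zp; have [_ zd] := pout z zp; rewrite mem_cat negb_or dpq // andbT.
    by apply: contra y2t => zt; rewrite -(zd (t_d z zt)).
  + move=> z zs; rewrite !mem_cat !negb_or; apply/and3P; split.
    * by apply/negP=> /pout[/negP[]]; apply: s_c.
    * by apply: contra x1s => /t_d/(dcd z (s_c z zs)) <-.
    * by apply/negP => /qout[_ /(_ (s_c z zs)) E]; rewrite -E zs in x1s.
- by case: cC => _ c3 _; apply: leq_trans c3 (ltnW sz).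
- case: (s ++ p ++ t ++ q) P L => //= a r /andP[ea rP] la.
  by rewrite rcons_path rP la.
Qed.

Lemma is_cycle_mem c : is_cycle e c -> exists x, x \in c.
Proof. by case; case: c => // x c _ _ _; exists x; apply: mem_head. Qed.

Lemma is_cycle_other c v : is_cycle e c -> exists2 x, x \in c & x != v.
Proof.
case; case: c => [|a [|b c]] //= /andP[]; rewrite inE negb_or => /andP[ab _] _ _ _.
by have [E|nav] := eqVneq a v; [exists b; rewrite ?inE ?eqxx ?orbT // -E eq_sym|
  exists a; rewrite ?inE ?eqxx].
Qed.

Lemma longest_cycles_meet c d : longest_cycle e c -> longest_cycle e d ->
  exists x y, [/\ x != y, x \in c, y \in c, x \in d & y \in d].
Proof.
move=> [cC cmax] [dC dmax].
have scd : size c = size d by apply/eqP; rewrite eqn_leq dmax // cmax.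
have no_longer : ~ (exists2 c', is_cycle e c' & size c < size c').
  by case=> c' /cmax le_c'; rewrite ltnNge le_c'.
have [/hasP[v vc vd]|/hasPn nI] := boolP (has (mem d) c); last first.
  (* Disjoint cycles: two disjoint paths from [d] to [c] are trimmed to touch each cycle only at
     their ends. *)
  case: no_longer.
  have [d1 d1d] := is_cycle_mem dC.
  have [d2 d2d d21] := is_cycle_other d1 dC.
  have [c1 c1c] := is_cycle_mem cC.
  have [c2 c2c c21] := is_cycle_other c1 cC.
  have [r [rP lr _ _]] : exists p, [/\ path e d1 p, last d1 p \in mem c, uniq (d1 :: p) & d2 \notin d1 :: p].
    by apply: (path_avoiding c2c c1c c21); rewrite eq_sym.
  have [p [q [pP qP lp lq /cat_uniqP[up uq dpq]]]] := disjoint_paths_exist c2c c1c c21 rP lr d21.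
  have [y1 [p1 [p1P up1 sub1 [y1d x1c] only1]]] := trim_path pP up d2d lp.
  have [y2 [q1 [q1P uq1 sub2 [y2d x2c] only2]]] := trim_path qP uq d1d lq.
  have [q2 [q2P lq2 uq2 _ eq2]] := rev_upath q1P uq1.
  have neq z1 z2 : z1 \in y1 :: p1 -> z2 \in y2 :: q1 -> z1 != z2.
    by move=> /sub1/dpq + /sub2 z2q; apply: contraNneq => ->.
  apply: (join_cycles cC dC scd x1c x2c _ y1d y2d _ q2P lq2 uq2 p1P (erefl _) up1).
  - by apply: neq; rewrite mem_last.
  - by apply: neq; rewrite mem_head.
  - move=> z zq2; have /only2[zd zc] : z \in y2 :: q1 by rewrite -eq2 inE zq2 orbT.
    split=> //; apply/negP=> /zc E; move: uq2 => /andP[/negP[]]; by rewrite -E.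
  - move=> z zp1; have /only1[zd zc] : z \in y1 :: p1 by rewrite inE zp1 orbT.
    split=> //; apply/negP=> /zd E; move: up1 => /andP[/negP[]]; by rewrite -E.
  - move=> z zq2; apply/negP=> zp1; suff: z != z by rewrite eqxx.
    by apply: neq; rewrite -?eq2 inE ?zp1 ?zq2 orbT.
  - by move=> z /nI/negP.
  - case: q2 lq2 {q2P uq2 eq2} => // E; case/negP: (nI _ x2c).
    by rewrite /= in E; rewrite /= E.
have [/hasP[w wc /andP[wv wd]]|/hasPn nw] := boolP (has (fun w => (w != v) && (w \in d)) c).
  by exists w, v.
(* A single common vertex [v]: one connection is a path avoiding [v], the other is [v] itself, so
   [q] is empty. *)
case: no_longer.
have [x xc xv] := is_cycle_other v cC; have [y yd yv] := is_cycle_other v dC.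
have [||p [pP lp up sub]] := @connected_in_path [set~ v] x y (@conD1 v).
- by rewrite !inE.
- by rewrite !inE.
have [|x2 [p2 [p2P up2 sub2 [x2c y2d] only]]] := @trim_path (mem c) (mem d) x p pP up xc.
  by rewrite lp.
have nv z : z \in x2 :: p2 -> z != v by move=> /sub2/sub; rewrite !inE.
apply: (@join_cycles c d v x2 v (last x2 p2) p2 [::]) => //.
- by rewrite eq_sym nv ?mem_head.
- by rewrite eq_sym nv ?mem_last.
- move=> z zp; have /only[zc zd] : z \in x2 :: p2 by rewrite inE zp orbT.
  split=> //; apply/negP=> /zc E; move: up2 => /andP[/negP[]]; by rewrite -E.
- by move=> z zc zd; apply/eqP; apply: contraNT (nw z zc) => ->.
- case: p2 y2d nv {p2P up2 sub2 only} => //= x2d nv.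
  by move/negP: (nw _ x2c); rewrite /= x2d nv ?mem_head.
Qed.

End TwoConnected.

(** * Components left by cliques in a k-tree *)

Section KTrees.
Variables (U : finType) (e : rel U) (k : nat).
Hypothesis e_sym : symmetric e.

Definition induced (S : {set U}) : rel U := [rel a b | [&& e a b, a \in S & b \in S]].

Lemma sub_induced (S S' : {set U}) x y :
  S \subset S' -> connect (induced S) x y -> connect (induced S') x y.
Proof.
move=> /subsetP sSS'; apply: connect_sub => a b /and3P[eab aS bS].
by apply: connect1; rewrite /induced /= eab !sSS'.
Qed.

Lemma connect_induced_sym S : connect_sym (induced S).
Proof.
by apply: sym_connect_sym => a b; rewrite /induced /= e_sym [(b \in S) && _]andbC.
Qed.

Lemma clique_sub (C D : {set U}) : C \subset D -> clique e D -> clique e C.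
Proof. by move=> /subsetP sCD clD x y /sCD xD /sCD yD; apply: clD. Qed.

(** Induction on the construction. If the last vertex [v] is off [Q], it is itself an apex or has a
    neighbour off [Q] to which induction applies. If [v] is in [Q], the one vertex [b] of [C]
    outside [Q] is an apex. *)
Lemma ktree_apex S : ktree_on e k S -> forall (Q : {set U}) x,
    Q \subset S -> #|Q| = k -> clique e Q -> x \in S :\: Q ->
  exists b, [/\ b \in S :\: Q, {in Q, forall q, e b q}
              & connect (induced (S :\: Q)) x b].
Proof.
elim=> {S} [S cS _|S v C ktS IH vS CS cC clC nbr] Q x QS cQ clQ.
  have -> : Q = S by apply/eqP; rewrite eqEcard QS cQ cS leqnn.
  by rewrite setDv inE.
have vC u : u \in C -> e v u by rewrite -nbr inE => /andP[].
have Cv u : u \in S -> e v u -> u \in C by rewrite -nbr inE => -> ->.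
have inS u : u \in C -> u \in S by move/subsetP: CS; apply.
have [vQ|vQ] := boolP (v \in Q); last first.
  have {}QS : Q \subset S.
    apply/subsetP=> q qQ; move/subsetP: QS => /(_ q qQ).
    by rewrite !inE => /predU1P[E|//]; rewrite -E qQ in vQ.
  have IHx y : y \in S :\: Q -> exists b, [/\ b \in (v |: S) :\: Q,
      {in Q, forall q, e b q} & connect (induced ((v |: S) :\: Q)) y b].
    move=> yS; have [b [bS bQ yb]] := IH Q y QS cQ clQ yS.
    exists b; split=> //; first by move: bS; rewrite !inE => /andP[-> ->]; rewrite orbT.
    by apply: sub_induced yb; rewrite setSD ?subsetUr.
  rewrite !inE => /andP[xQ /predU1P[xv|xS]]; last by apply: IHx; rewrite !inE xQ.
  subst x.
  have [QC|/subsetPn[c cC' cQ']] := boolP (C \subset Q).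
    exists v; split; [by rewrite !inE eqxx vQ| |exact: connect0] => q qQ.
    by apply: vC; have /eqP -> : C == Q by rewrite eqEcard QC cC cQ leqnn.
  have [|b [? ? cb]] := IHx c; first by rewrite !inE cQ' inS.
  exists b; split=> //; apply: connect_trans cb; apply: connect1.
  by rewrite /induced /= vC // !inE vQ cQ' eqxx (inS _ cC') orbT.
have QvC : Q :\ v \subset C.
  apply/subsetP=> q; rewrite !inE => /andP[qv qQ]; apply: Cv.
    by move/subsetP: QS => /(_ q qQ); rewrite !inE (negbTE qv).
  by apply: clQ; rewrite // eq_sym.
have cQv : #|Q :\ v|.+1 = k by rewrite -cQ (cardsD1 v Q) vQ.
have [b bC bQv] : exists2 b, b \in C & b \notin Q :\ v.
  by apply/subsetPn/negP=> /subset_leq_card; rewrite cC -cQv ltnn.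
have bS := inS b bC.
have bv : b != v by apply: contraTneq bS => ->.
have bQ : b \notin Q by move: bQv; rewrite !inE bv.
have CE u : u \in C -> u \notin Q -> u = b.
  move=> uC uQ; apply/eqP/negPn/negP=> ub.
  have: #|u |: (b |: (Q :\ v))| <= #|C|.
    apply: subset_leq_card; rewrite !subUset !sub1set uC bC QvC //.
  by rewrite !cardsU1 !inE (negbTE ub) (negbTE uQ) (negbTE bQ) !andbF /= !add1n cQv cC ltnn.
have eb : {in Q, forall q, e b q}.
  move=> q qQ; have [->|qv] := eqVneq q v; first by rewrite e_sym vC.
  have qC : q \in C by move/subsetP: QvC; apply; rewrite !inE qv.
  by apply: clC => //; apply: contraNneq bQ => ->.
rewrite !inE => /andP[xQ /predU1P[xv|xS]]; first by rewrite xv vQ in xQ.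
exists b; split=> //; first by rewrite !inE bQ bS orbT.
have [->|xb] := eqVneq x b; first exact: connect0.
have xC : x \notin C by apply: contra xb => /CE->.
(* Induction is applied to [C] instead of [Q]: the apex [b'] it gives is adjacent to all of [C], in
   particular to [b], so [x] reaches [b]. *)
have [|b' [b'S b'C xb']] := IH C x CS cC clC; first by rewrite !inE xC.
have sub : S :\: C \subset (v |: S) :\: Q.
  apply/subsetP=> y; rewrite !inE => /andP[yC yS]; rewrite yS orbT andbT.
  apply: contra yC => yQ; move/subsetP: QvC; apply; rewrite !inE yQ andbT.
  by apply: contraTneq yS => ->.
apply: connect_trans (sub_induced sub xb') _; apply: connect1.
by rewrite /induced /= b'C // (subsetP sub) // !inE bQ bS orbT.
Qed.

(* The last clause makes [H] a union of components of [S :\: B]; some vertex of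
   the clique [B] therefore has no neighbour in the component of [x]. *)
Lemma ktree_missing S : ktree_on e k S -> forall (B : {set U}) x,
    B \subset S -> #|B| = k.+1 -> clique e B -> x \in S :\: B ->
  exists (H : {set U}) m, [/\ x \in H, H \subset S :\: B, m \in B, {in H, forall h, ~~ e m h}
    & {in H & S :\: B, forall h y, e h y -> y \in H}].
Proof.
elim=> {S} [S cS _|S v C ktS IH vS CS cC clC nbr] B x BS cB clB.
  by move/subset_leq_card: BS; rewrite cB cS ltnn.
have vC u : u \in C -> e v u by rewrite -nbr inE => /andP[].
have Cv u : u \in S -> e v u -> u \in C by rewrite -nbr inE => -> ->.
have inS u : u \in C -> u \in S by move/subsetP: CS; apply.
have [vB|vB] := boolP (v \in B).
  have BvC : B :\ v \subset C.
    apply/subsetP=> q; rewrite !inE => /andP[qv qB]; apply: Cv.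
      by move/subsetP: BS => /(_ q qB); rewrite !inE (negbTE qv).
    by apply: clB; rewrite // eq_sym.
  have EC : B :\ v = C.
    by apply/eqP; rewrite eqEcard BvC cC -ltnS -cB (cardsD1 v B) vB add1n leqnn.
  (* All neighbours of [v] are in [B], so [v] misses everything off [B]. *)
  move=> xS; exists ((v |: S) :\: B), v; split=> // h; rewrite !inE => /andP[hB].
  case/predU1P=> [E|hS]; first by rewrite E vB in hB.
  apply: contra hB => /(Cv h hS); rewrite -EC !inE => /andP[] //.
have {}BS : B \subset S.
  apply/subsetP=> q qB; move/subsetP: BS => /(_ q qB).
  by rewrite !inE => /predU1P[E|//]; rewrite -E qB in vB.
have inB u : u \in B -> u \in S by move/subsetP: BS; apply.
(* When [v] has a neighbour [c] in [H], it can join [H]: the other neighbours of [v] lie in the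
   clique [C], hence are adjacent to [c], which excludes [m] and keeps the set closed. *)
have extend (H : {set U}) m c : c \in C -> c \in H -> H \subset S :\: B -> m \in B ->
    {in H, forall h, ~~ e m h} -> {in H & S :\: B, forall h y, e h y -> y \in H} ->
  [/\ v |: H \subset (v |: S) :\: B, {in v |: H, forall h, ~~ e m h}
    & {in v |: H & (v |: S) :\: B, forall h y, e h y -> y \in v |: H}].
  move=> cC' cH /subsetP HS mB nadj closed; split.
  - apply/subsetP=> y; rewrite in_setU1 => /predU1P[->|/HS]; rewrite !inE ?vB ?eqxx //.
    by case/andP=> -> ->; rewrite orbT.
  - move=> h; rewrite in_setU1 => /predU1P[->|]; last exact: nadj.
    rewrite e_sym; apply/negP=> /(Cv m (inB m mB)) mC.
    case/negP: (nadj c cH); apply: clC => //; apply: contraTneq mB => ->.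
    by move/HS: cH; rewrite inE => /andP[].
  - move=> h y; rewrite in_setU1 => hH; rewrite !inE.
    case: eqP => //= _ /andP[yB yS] ehy; have yS' : y \in S :\: B by rewrite inE yB.
    case/predU1P: hH ehy => [->|hH]; last exact: (closed h y).
    move=> /(Cv y yS) yC; have [->//|cy] := eqVneq y c.
    by apply: (closed c y) => //; apply: clC => //; rewrite eq_sym.
rewrite !inE => /andP[xB /predU1P[xv|xS]].
  (* If [C] is inside [B], then [v] is alone in its component, and the vertex of [B] outside [C]
     misses it. *)
  subst x; have [CB|/subsetPn[c cC' cB']] := boolP (C \subset B).
    have [m mB mC] : exists2 m, m \in B & m \notin C.
      by apply/subsetPn/negP=> /subset_leq_card; rewrite cC cB ltnn.
    exists [set v], m; split; rewrite ?set11 //.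
    + by rewrite sub1set !inE vB eqxx.
    + by move=> h /set1P->; rewrite e_sym; apply: contra mC; apply: Cv; apply: inB.
    + move=> h y /set1P->; rewrite !inE => /andP[yB /predU1P[->|yS]]; first by rewrite eqxx.
      by move=> /(Cv y yS) /(subsetP CB) E; rewrite E in yB.
  have [|H [m [cH HS mB nadj closed]]] := IH B c BS cB clB.
    by rewrite !inE cB' inS.
  have [] := extend H m c => // H1 H2 H3.
  by exists (v |: H), m; split; rewrite // setU11.
have [|H [m [xH HS mB nadj closed]]] := IH B x BS cB clB; first by rewrite !inE xB.
have [/exists_inP[c cC' cH]|/exists_inPn nC] := boolP [exists c in C, c \in H].
  have [] := extend H m c => // H1 H2 H3.
  by exists (v |: H), m; split; rewrite // in_setU1 xH orbT.
exists H, m; split=> //; first by apply: subset_trans HS _; rewrite setSD ?subsetUr.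
move=> h y hH; rewrite !inE => /andP[yB /predU1P[->|yS]] ehy; last first.
  by apply: (closed h y); rewrite // inE yB.
have hS : h \in S by move/subsetP: HS => /(_ h hH); rewrite inE => /andP[].
by have /nC/negP[] : h \in C by apply: Cv; rewrite // e_sym.
Qed.
End KTrees.

Lemma cardsD1_pred (U : finType) (A : {set U}) a m : a \in A -> #|A| = m.+1 -> #|A :\ a| = m.
Proof. by move=> aA; rewrite (cardsD1 a A) aA => -[]. Qed.

Lemma ktree_base (U : finType) (e : rel U) k S :
  ktree_on e k S -> exists2 Q : {set U}, #|Q| = k & clique e Q.
Proof. by elim=> // {}S cS clS; exists S. Qed.

(** * Longest cycles and cliques of the host k-tree *)

Section PartialKTrees.
Variables (T U : finType) (e : rel T) (eU : rel U) (f : T -> U) (k : nat).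
Hypotheses (e_sym : symmetric e) (e_irr : irreflexive e).
Hypothesis conD1 : forall v, connected_in e [set~ v].
Hypotheses (f_inj : injective f) (eU_sym : symmetric eU).
Hypothesis f_hom : forall x y, e x y -> eU (f x) (f y).
Hypothesis ktU : ktree_on eU k [set: U].
Hypothesis no_transversal :
  forall S : {set T}, #|S| <= k.-1 -> ~ hits_longest_cycles e S.

Definition meets_at_most_once (c : seq T) (Q : {set U}) :=
  {in c &, forall x y, f x \in Q -> f y \in Q -> x = y}.

Notation linked Q := (connect (induced eU (~: Q))).

(* Existence is stated in double-negated form, so that no choice is needed. *)
Lemma longest_cycle_avoiding (Q : {set U}) : #|Q| <= k.-1 ->
  (forall c, longest_cycle e c -> {in c, forall x, f x \notin Q} -> False) -> False.
Proof.
move=> cQ no_c; apply: (@no_transversal (f @^-1: Q)).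
  apply: leq_trans cQ; rewrite -(card_imset _ f_inj); apply: subset_leq_card.
  by apply/subsetP=> _ /imsetP[x + ->]; rewrite inE.
move=> c cL; apply/negPn/negP=> /hasPn nQ; apply: (no_c c cL) => x /nQ.
by rewrite inE.
Qed.

(** A cycle that avoids [Q] minus one vertex [q] can meet [Q] only in [q]. For [k = 0] the set [Q]
    is empty and any longest cycle serves. *)
Lemma longest_cycle_meeting_once (Q : {set U}) : #|Q| = k ->
  (forall c, longest_cycle e c -> meets_at_most_once c Q -> False) -> False.
Proof.
move=> cQ no_c; have [Q0|[q qQ]] := set_0Vmem Q.
  apply: (@longest_cycle_avoiding Q); first by rewrite Q0 cards0.
  by move=> c cL nQ; apply: (no_c c cL) => x y /nQ/negbTE->.
apply: (@longest_cycle_avoiding (Q :\ q)).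
  by rewrite -cQ (cardsD1 q Q) qQ.
move=> c cL nQ; apply: (no_c c cL).
have fq z : z \in c -> f z \in Q -> f z = q.
  by move=> /nQ + zQ; rewrite !inE zQ andbT negbK => /eqP.
move=> x y xc yc xQ yQ; apply: f_inj; exact: (etrans (fq x xc xQ) (esym (fq y yc yQ))).
Qed.

Lemma path_linked (Q : {set U}) x p : path e x p -> {in x :: p, forall z, f z \notin Q} ->
  {in x :: p &, forall y z, linked Q (f y) (f z)}.
Proof.
move=> pP nQ.
suff lx z : z \in x :: p -> linked Q (f x) (f z).
  move=> y z /lx xy /lx xz; apply: connect_trans xz.
  by rewrite connect_induced_sym.
elim: p x pP nQ => [|a p IH] x /=; first by move=> _ _ /predU1P[->|//]; apply: connect0.
move=> /andP[exa pP] nQ; rewrite inE => /predU1P[->|zp]; first exact: connect0.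
apply: connect_trans (IH a pP _ zp); last by move=> y yp; apply: nQ; rewrite inE yp orbT.
by apply: connect1; rewrite /induced /= f_hom // !inE !nQ // !inE eqxx ?orbT.
Qed.

(** Deleting at most one vertex from a cycle leaves it connected. *)
Lemma cycle_linked c (Q : {set U}) : is_cycle e c -> meets_at_most_once c Q ->
  {in c &, forall x y, f x \notin Q -> f y \notin Q -> linked Q (f x) (f y)}.
Proof.
move=> [uc c3 cc] cQ x y xc yc xQ yQ.
have [/hasP[z zc zQ]|/hasPn nQ] := boolP (has (fun z => f z \in Q) c); last first.
  case: c {c3 cQ uc} cc xc yc nQ => // h t; rewrite /= rcons_path => /andP[hP _] xc yc nQ.
  exact: (path_linked hP nQ).
case: (rot_to zc) => i c' Ec.
have cE : c =i z :: c' by move=> w; rewrite -Ec mem_rot.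
have uc' : uniq (z :: c') by rewrite -Ec rot_uniq.
have cc' : cycle e (z :: c') by rewrite -Ec rot_cycle.
have inc' w : w \in c -> f w \notin Q -> w \in c'.
  by rewrite cE inE => /predU1P[->|//]; rewrite zQ.
move: {xc yc} (inc' x xc xQ) (inc' y yc yQ).
case: c' uc' cc' cE {Ec inc'} => // h t /andP[zht _].
rewrite /= rcons_path => /and3P[_ hP _] cE xh yh; apply: (path_linked hP) => // w wh.
apply/negP=> wQ; case/negP: zht; rewrite -(cQ w z) //.
by rewrite cE inE wh orbT.
Qed.

(** Of two vertices shared by the cycles, at most one is in [Q]; the other links the cycles off
    [Q]. *)
Lemma longest_linked c d (Q : {set U}) x y : longest_cycle e c -> longest_cycle e d ->
    meets_at_most_once c Q -> meets_at_most_once d Q -> x \in c -> y \in d ->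
    f x \notin Q -> f y \notin Q -> linked Q (f x) (f y).
Proof.
move=> cL dL cQ dQ xc yd xQ yQ.
have [w1 [w2 [w12 w1c w2c w1d w2d]]] := longest_cycles_meet e_sym e_irr conD1 cL dL.
have [w [wc wd wQ]] : exists w, [/\ w \in c, w \in d & f w \notin Q].
  have [w1Q|] := boolP (f w1 \in Q); last by exists w1.
  exists w2; split=> //; apply: contra w12 => w2Q; exact/eqP/cQ.
apply: (@connect_trans _ _ (f w)).
  by apply: (cycle_linked (proj1 cL) cQ).
by apply: (cycle_linked (proj1 dL) dQ).
Qed.

Lemma cycle_off c (Q : {set U}) : is_cycle e c -> meets_at_most_once c Q ->
  exists2 x, x \in c & f x \notin Q.
Proof.
move=> cC cQ; have [x xc] := is_cycle_mem cC.
have [y yc yx] := is_cycle_other x cC.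
have [xQ|] := boolP (f x \in Q); last by exists x.
by exists y; rewrite //; apply: contra yx => yQ; apply/eqP/cQ.
Qed.

(* A longest cycle meeting a [k]-clique [Q] at most once lies, off [Q], in one
   component of [~: Q], the same for all such cycles; [pointed B] says that for
   every [b] in [B] the component singled out by [B :\ b] is that of [b]. *)
Definition pointed (B : {set U}) := [/\ #|B| = k.+1, clique eU B
  & forall b c x, b \in B -> longest_cycle e c -> meets_at_most_once c (B :\ b) ->
    x \in c -> f x \notin B :\ b -> linked (B :\ b) (f x) b].

(* The descent is on the size of the component singled out by [Q]: if [Q] and an
   apex [b] of that component do not form a pointed clique, another [k]-subset of
   [b |: Q] singles out a strictly smaller component. *)
Lemma pointed_descent n (Q : {set U}) c x :
    #|Q| = k -> clique eU Q -> longest_cycle e c -> meets_at_most_once c Q ->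
    x \in c -> f x \notin Q -> #|[set y | linked Q (f x) y]| < n ->
  (forall B, pointed B -> False) -> False.
Proof.
elim: n Q c x => // n IH Q c x cQ clQ cL cQ1 xc xQ ltn no_B.
have [||b []] := ktree_apex eU_sym ktU (Q := Q) (x := f x) _ cQ clQ.
- exact: subsetT.
- by rewrite !inE xQ.
rewrite !setTD inE => bQ eb xb.
have cB : #|b |: Q| = k.+1 by rewrite cardsU1 bQ cQ.
have clB : clique eU (b |: Q).
  move=> y z; rewrite !in_setU1 => /predU1P[->|yQ] /predU1P[->|zQ] yz.
  - by rewrite eqxx in yz.
  - exact: eb.
  - by rewrite eU_sym eb.
  - exact: clQ.
have DbQ : (b |: Q) :\ b = Q by rewrite setU1K.
apply: (no_B (b |: Q)); split=> // b' d y b'B dL dQ' yd yQ'.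
apply/negPn/negP=> nlink; set Q' := (b |: Q) :\ b' in dQ' yQ' nlink.
have [Eb|nb] := eqVneq b' b.
  have EQ : Q' = Q by rewrite /Q' Eb.
  move: dQ' yQ' nlink; rewrite EQ => dQ yQ /negP[]; rewrite Eb.
  by apply: connect_trans xb; apply: (longest_linked dL cL).
have b'Q : b' \in Q by move: b'B; rewrite in_setU1 (negbTE nb).
(* Since [b'] is not in [Q'], a cycle [d] through [b'] would link [f y] to [b']. Hence [d] avoids
   [b'] and meets all of [b |: Q] at most once. *)
have b'd z : z \in d -> f z != b'.
  move=> zd; apply: contra nlink => /eqP E; rewrite -E.
  by apply: (cycle_linked (proj1 dL) dQ'); rewrite // E !inE eqxx.
have dB : meets_at_most_once d (b |: Q).
  by move=> z w zd wd zB wB; apply: dQ'; rewrite // in_setD1 b'd.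
have dQ : meets_at_most_once d Q.
  by move=> z w zd wd zQ wQ; apply: dB; rewrite // in_setU1 ?zQ ?wQ orbT.
have [z zd zB] := cycle_off (proj1 dL) dB.
have zQ : f z \notin Q by apply: contra zB; rewrite in_setU1 => ->; rewrite orbT.
have zQ' : f z \notin Q' by apply: contra zB; rewrite in_setD1 => /andP[].
have yz : linked Q' (f y) (f z) by apply: (cycle_linked (proj1 dL) dQ').
apply: (IH Q' d y _ _ dL dQ' yd yQ' _ no_B).
- exact: cardsD1_pred cB.
- by apply: clique_sub clB; apply: subD1set.
have bQ' : b \in Q' by rewrite !inE eqxx eq_sym nb.
(* The component of [f y] off [Q'] avoids [b'], the only vertex of [Q] outside [Q']; so it lies
   within a component off [Q], namely that of [f x]. *)
have off_b' w : linked Q' (f y) w -> w != b' by apply: contraTneq => ->.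
have zw w : linked Q' (f y) w -> linked Q (f z) w.
  move=> yw; have: linked Q' (f z) w.
    by apply: connect_trans yw; rewrite connect_induced_sym.
  case/connectP=> p pP ->; elim: p (f z) yz pP => [|a p IHp] u yu /=.
    by move=> _; apply: connect0.
  move=> /andP[ua pP]; have ya := connect_trans yu (connect1 ua).
  apply: connect_trans (IHp a ya pP); apply: connect1.
  move: ua; rewrite /induced /= => /and3P[-> uQ aQ].
  have notQ t : linked Q' (f y) t -> t \in ~: Q' -> t \in ~: Q.
    by move=> /off_b' tb; rewrite !inE tb negb_or => /andP[].
  by rewrite !notQ.
apply: leq_trans (_ : #|[set y0 | linked Q (f x) y0]| <= n) => //.
apply: proper_card; apply/properP; split.
  apply/subsetP=> w; rewrite !inE => /zw; apply: connect_trans.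
  exact: (longest_linked cL dL).
(* The inclusion is strict at [b]: it is in the component of [f x], but belongs to [Q'] and so has
   no edge in the graph induced off [Q']. *)
exists b; rewrite inE //; apply/negP=> yb.
have: connect (induced eU (~: Q')) b (f y) by rewrite connect_induced_sym.
case/connectP=> -[|a p] /=; first by move=> _ E; rewrite E bQ' in yQ'.
by rewrite /induced /= in_setC bQ' andbF.
Qed.

Lemma pointed_exists : (forall B, pointed B -> False) -> False.
Proof.
have [Q cQ clQ] := ktree_base ktU.
move=> no_B; apply: (longest_cycle_meeting_once cQ) => c cL cQ1.
have [x xc xQ] := cycle_off (proj1 cL) cQ1.
exact: (pointed_descent cQ clQ cL cQ1 xc xQ (ltnSn _) no_B).
Qed.

(** * Longest cycles around a pointed clique, and the contradiction *)

Definition missed_by (B H : {set U}) m :=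
  [/\ m \in B, H \subset ~: B, {in H, forall h, ~~ eU m h}
    & {in H & ~: B, forall h y, eU h y -> y \in H}].

Lemma missed_by_exists (B : {set U}) x : #|B| = k.+1 -> clique eU B -> x \notin B ->
  exists (H : {set U}) m, x \in H /\ missed_by B H m.
Proof.
move=> cB clB xB.
have [||H [m []]] := ktree_missing eU_sym ktU (B := B) (x := x) _ cB clB.
- exact: subsetT.
- by rewrite !inE xB.
by rewrite setTD => *; exists H, m.
Qed.

Lemma linked_closed (Q H : {set U}) x y :
    {in H & ~: Q, forall h z, eU h z -> z \in H} ->
  linked Q x y -> x \in H -> y \in H.
Proof.
move=> clH; case/connectP=> p + ->; elim: p x => //= a p IH x /andP[/and3P[xa _ aQ] pP] xH.
by apply: IH pP _; apply: clH xa.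
Qed.

(** Otherwise [c] has a vertex in some [H] missed by [m], and pointedness links it to [m] off
    [B :\ m]. As [m] has no neighbour in [H], that link cannot leave [H], which would put [m] in
    [H]. *)
Lemma pointed_meets_twice B c : pointed B -> longest_cycle e c -> ~ meets_at_most_once c B.
Proof.
move=> [cB clB ptB] cL cB1; have [x xc xB] := cycle_off (proj1 cL) cB1.
have [H [m [xH [mB HB nadj clH]]]] := missed_by_exists cB clB xB.
have mH : m \in H.
  apply: (@linked_closed (B :\ m) _ (f x)) => //; last first.
    apply: (ptB m c) => //; last by apply: contra xB; rewrite in_setD1 => /andP[].
    by move=> y z yc zc; rewrite !in_setD1 => /andP[_ ?] /andP[_ ?]; apply: cB1.
  move=> h z hH; rewrite !inE negb_and negbK => /predU1P[->|zB] ehz.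
    by case/negP: (nadj h hH); rewrite eU_sym.
  by apply: (clH h); rewrite // inE.
by move/subsetP: HB => /(_ m mH); rewrite inE mB.
Qed.

Definition crosses (B : {set U}) a b c := longest_cycle e c /\ exists x y,
  [/\ x \in c, y \in c, f x = a, f y = b
    & {in c, forall z, f z \in B -> z = x \/ z = y}].

(** Removing [a] and [b] leaves [k.-1] vertices of [B], which some longest cycle avoids; it meets
    [B] more than once, hence in both [a] and [b]. *)
Lemma crosses_exists B a b : pointed B -> a \in B -> b \in B -> a != b ->
  (forall c, crosses B a b c -> False) -> False.
Proof.
move=> ptB aB bB ab no_c; have [cB _ _] := ptB.
have aBb : a \in B :\ b by rewrite !inE ab.
have cBb := cardsD1_pred bB cB.
apply: (@longest_cycle_avoiding (B :\ b :\ a)).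
  by rewrite -cBb [leqRHS](congr1 predn (cardsD1 a (B :\ b))) aBb.
move=> c cL nQ; have only z : z \in c -> f z \in B -> f z = a \/ f z = b.
  move=> /nQ + zB; rewrite !inE zB andbT -negb_or negbK.
  by case/orP=> /eqP; [left|right].
have both d d' : (forall z, z \in c -> f z \in B -> f z = d \/ f z = d') ->
    exists2 x, x \in c & f x = d.
  move=> only'; have [/hasP[x xc /eqP]|/hasPn nd] := boolP (has (fun x => f x == d) c).
    by exists x.
  case: (pointed_meets_twice ptB cL) => x y xc yc xB yB; apply: f_inj.
  have E z : z \in c -> f z \in B -> f z = d'.
    by move=> zc /(only' z zc)[] // /eqP E; case/negP: (nd z zc).
  exact: (etrans (E x xc xB) (esym (E y yc yB))).
have [x xc xa] := both a b only.
have [|y yc yb] := both b a; first by move=> z zc /(only z zc)[]; [right|left].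
apply: (no_c c); split=> //; exists x, y; split=> // z zc /(only z zc)[] E; [left|right].
  by apply: f_inj; rewrite E.
by apply: f_inj; rewrite E.
Qed.

(** The inside of the arc cannot leave [H], so both ends of the arc have a neighbour in [H], unlike
    [m]. *)
Lemma arc_missed (B H : {set U}) m x y s z : missed_by B H m ->
    path e x (rcons s y) -> {in s, forall w, f w \notin B} -> z \in s -> f z \in H ->
  [/\ {in s, forall w, f w \in H}, m != f x & m != f y].
Proof.
move=> [mB HB nadj clH] sP sB zs zH.
have sH : {in s, forall w, f w \in H}.
  move=> w ws; apply: linked_closed clH _ zH.
  case: s sP sB zs ws => // h s; rewrite /= rcons_path => /and3P[_ sP _] sB zs ws.
  exact: (path_linked sP sB).
split=> //.
  case: s zs sP sH {sB} => // h s _ /andP[xh _] sH; apply: contraTneq (f_hom xh) => <-.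
  by apply: nadj; apply: sH; apply: mem_head.
case/lastP: s zs sP sH {sB} => // s l _; rewrite rcons_path last_rcons => /andP[_ ly] sH.
apply: contraTneq (f_hom ly) => <-; rewrite eU_sym.
by apply: nadj; apply: sH; rewrite mem_rcons mem_head.
Qed.

Lemma crosses_split (B : {set U}) a b c : a != b -> a \in B -> b \in B -> crosses B a b c ->
  exists x y s t, [/\ f x = a, f y = b, path e x (rcons s y), path e y (rcons t x)
    & [/\ 0 < size s + size t, {in s, forall w, f w \notin B}, {in t, forall w, f w \notin B}
    & {in c, forall w, f w \notin B -> w \in s \/ w \in t}]].
Proof.
move=> ab aB bB [[cC _] [x [y [xc yc xa yb only]]]].
have xy : x != y by apply: contra ab => /eqP E; rewrite -xa -yb E.
have [s [t [sP tP uc cE szc]]] := cycle_split cC xc yc xy.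
have in_c w : w \in s \/ w \in t -> w \in c.
  by rewrite cE !inE mem_cat inE => -[]->; rewrite ?orbT.
have off w : w \in s \/ w \in t -> f w \notin B.
  move=> wst; apply/negP=> /(only w (in_c w wst)) wxy.
  move: uc; rewrite cons_uniq mem_cat inE !negb_or => /andP[/and3P[xs _ xt] /cat_uniqP[_ /andP[yt _] ys]].
  case: wst wxy => [ws|wt] [] E; subst w.
  - by rewrite ws in xs.
  - by move: (ys y ws); rewrite mem_head.
  - by rewrite wt in xt.
  - by rewrite wt in yt.
exists x, y, s, t; split=> //; split.
- by case: cC => _; rewrite szc.
- by move=> w ws; apply: off; left.
- by move=> w wt; apply: off; right.
- move=> w; rewrite cE inE mem_cat inE => /or4P[/eqP->|->|/eqP->|->].
  + by rewrite xa aB.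
  + by left.
  + by rewrite yb bB.
  + by right.
Qed.

Lemma crosses_missed (B H : {set U}) m a b c w : a != b -> a \in B -> b \in B ->
    crosses B a b c -> missed_by B H m -> w \in c -> f w \in H -> m != a /\ m != b.
Proof.
move=> ab aB bB crc mis wc wH.
have [x [y [s [t [xa yb sP tP [_ sB tB cst]]]]]] := crosses_split ab aB bB crc.
have wB : f w \notin B.
  by case: mis => _ /subsetP/(_ _ wH); rewrite inE.
case: (cst w wc wB) => [ws|wt].
  by have [_] := arc_missed mis sP sB ws wH; rewrite xa yb.
by have [_] := arc_missed mis tP tB wt wH; rewrite xa yb.
Qed.

Lemma arc_cover (B : {set U}) x y s : #|B| = k.+1 -> clique eU B ->
    path e x (rcons s y) -> {in s, forall w, f w \notin B} -> 0 < size s ->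
  exists (H : {set U}) m, [/\ missed_by B H m, m != f x, m != f y & {in s, forall w, f w \in H}].
Proof.
move=> cB clB sP sB; case: s sP sB => // z s sP sB _.
have [H [m [zH mis]]] := missed_by_exists cB clB (sB z (mem_head _ _)).
have [sH mx my] := arc_missed mis sP sB (mem_head z s) zH.
by exists H, m.
Qed.

Lemma crosses_cover (B : {set U}) a b c : #|B| = k.+1 -> clique eU B ->
    a != b -> a \in B -> b \in B -> crosses B a b c ->
  exists (H1 : {set U}) m1 (H2 : {set U}) m2, [/\ missed_by B H1 m1, missed_by B H2 m2,
    m1 != a /\ m1 != b, m2 != a /\ m2 != b
  & {in c, forall w, f w \notin B -> f w \in H1 \/ f w \in H2}].
Proof.
move=> cB clB ab aB bB crc.
have [x [y [s [t [xa yb sP tP [st sB tB cst]]]]]] := crosses_split ab aB bB crc.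
(* An arc that is a single edge has no inner vertex; the pair found for the other arc then serves
   twice. *)
have [s0|s0] := posnP (size s).
  rewrite s0 in st; have [H [m [mis my mx tH]]] := arc_cover cB clB tP tB st.
  exists H, m, H, m; rewrite -xa -yb; split=> // w wc wB; left; apply: tH.
  by case: (cst w wc wB) => //; rewrite (size0nil s0).
have [H1 [m1 [mis1 m1x m1y sH]]] := arc_cover cB clB sP sB s0.
have [t0|t0] := posnP (size t).
  exists H1, m1, H1, m1; rewrite -xa -yb; split=> // w wc wB; left; apply: sH.
  by case: (cst w wc wB) => //; rewrite (size0nil t0).
have [H2 [m2 [mis2 m2y m2x tH]]] := arc_cover cB clB tP tB t0.
exists H1, m1, H2, m2; rewrite -xa -yb; split=> // w wc wB.
by case: (cst w wc wB) => [/sH|/tH]; [left|right].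
Qed.

Lemma crosses_image (B : {set U}) a b c w :
  crosses B a b c -> w \in c -> f w \in B -> f w = a \/ f w = b.
Proof.
by move=> [_ [x [y [_ _ <- <- only]]]] wc /(only w wc)[]->; [left|right].
Qed.

Lemma pointed_absurd B : pointed B -> False.
Proof.
move=> ptB; have [cB clB _] := ptB.
have [a aB] : exists a, a \in B by apply/card_gt0P; rewrite cB.
have [B1|[b]] := set_0Vmem (B :\ a).
  (* The degenerate case [k = 0]: a longest cycle exists because the empty set is no transversal,
     and it meets the singleton [B] at most once. *)
  have k0 : k = 0 by move: (cardsD1_pred aB cB); rewrite B1 cards0.
  apply: (@longest_cycle_avoiding set0) => [|c cL _]; first by rewrite cards0.
  apply: (pointed_meets_twice ptB cL) => x y xc yc.
  have BE z : z \in B -> z = a.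
    by move=> zB; apply/eqP/negPn/negP=> za; move/setP/(_ z): B1; rewrite !inE za zB.
  by move=> /BE xa /BE ya; apply: f_inj; rewrite xa ya.
rewrite in_setD1 eq_sym => /andP[ab bB].
apply: (crosses_exists ptB aB bB ab) => c crc.
have [H1 [m1 [H2 [m2 [mis1 mis2 [m1a m1b] [m2a m2b] cov]]]]] := crosses_cover cB clB ab aB bB crc.
have [m1B _ _ _] := mis1; have [m2B _ _ _] := mis2.
(* The second cycle must cross at both [m1] and [m2]. If these coincide, [a] completes the pair. *)
have [g [gB m1g m2g]] : exists g, [/\ g \in B, m1 != g & m2 = m1 \/ m2 = g].
  have [E|nE] := eqVneq m2 m1; first by exists a; split=> //; left.
  by exists m2; split; rewrite 1?eq_sym //; right.
apply: (crosses_exists ptB m1B gB m1g) => d crd.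
have [w1 [w2 [w12 w1c w2c w1d w2d]]] := longest_cycles_meet e_sym e_irr conD1 (proj1 crc) (proj1 crd).
(* A common vertex in [B] is not sent to [m1], which differs from [a] and [b], so it goes to [g].
   One off [B] would lie in [H1] or [H2], which [d] cannot enter. *)
have wg w : w \in c -> w \in d -> f w = g.
  move=> wc wd; have [wB|wB] := boolP (f w \in B).
    case: (crosses_image crd wd wB) => // wm.
    by case: (crosses_image crc wc wB) => wab; move: m1a m1b; rewrite -wm wab eqxx.
  case: (cov w wc wB) => [w1H|w2H].
    by have [] := crosses_missed m1g m1B gB crd mis1 wd w1H; rewrite eqxx.
  have [n1 n2] := crosses_missed m1g m1B gB crd mis2 wd w2H.
  by case: m2g => E; [rewrite E eqxx in n1|rewrite E eqxx in n2].
by case/eqP: w12; apply: f_inj; rewrite (wg w1 w1c w1d) (wg w2 w2c w2d).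
Qed.

End PartialKTrees.

Theorem theorem6p2 (T : finType) (e : rel T) (k n : nat) :
  simple_graph e -> partial_ktree e k -> two_connected e -> is_lct e n ->
  n <= k.-1.
Proof.
move=> [e_sym e_irr] [U [f [eU [f_inj [[eU_sym _] ktU] f_hom]]]] [_ _ conD1] [_ min_n].
rewrite leqNgt; apply/negP=> lt_n.
have no_transversal (S : {set T}) : #|S| <= k.-1 -> ~ hits_longest_cycles e S.
  by move=> cS /min_n le_n; move: (leq_trans lt_n (leq_trans le_n cS)); rewrite ltnn.
apply: (pointed_exists e_sym e_irr conD1 f_inj eU_sym f_hom ktU no_transversal) => B.
exact: (pointed_absurd e_sym e_irr conD1 f_inj eU_sym f_hom ktU no_transversal).
Qed.
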